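(* A (commutative) Hilbertian Frobenius semigroup is semisimple if, and only if, it has an approximate unit, if, and only if, it has an approximate counit. In particular, each special Hilbertian Frobenius semigroup has an approximate unit and an approximate counit.
   Context: All Hilbert spaces are complex; $\hat{\otimes}_2$ is the Hilbert space tensor product; $f^{\dagger}$ is the Hilbert adjoint. A Hilbertian semigroup is a pair $(H,\mu)$ with $H$ a Hilbert space and $\mu\colon H\hat{\otimes}_2H\to H$ bounded linear, associative and commutative (no unit assumed); write $xy:=\mu(x\otimes y)$. With $\alpha\colon (H\hat{\otimes}_2H)\hat{\otimes}_2H\to H\hat{\otimes}_2(H\hat{\otimes}_2H)$ the canonical unitary, it is a Hilbertian Frobenius semigroup when $(\mu\hat{\otimes}_2 id)\circ\alpha^{-1}\circ(id\hat{\otimes}_2\mu^{\dagger})=\mu^{\dagger}\circ\mu=(id\hat{\otimes}_2\mu)\circ\alpha\circ(\mu^{\dagger}\hat{\otimes}_2 id)$; it is special when $\mu\circ\mu^{\dagger}=id_H$. It is semisimple when the Jacobson radical of the commutative Banach algebra $H$ with product $(x,y)\mapsto xy$ (the intersection of the maximal modular ideals, equivalently of the kernels of the non-zero algebra maps to $\mathbb{C}$; equal to $H$ if there are none) is $(0)$. An approximate unit of $(H,\mu)$ is a net $(e_{\lambda})_{\lambda\in\Lambda}$ of elements of $H$ indexed by a directed set $\Lambda$ such that $ue_{\lambda}\to u$ in norm for each $u\in H$. An approximate counit is a net $(\epsilon_{\lambda}\colon H\to\mathbb{C})_{\lambda\in\Lambda}$ of bounded linear functionals indexed by a directed set such that for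 each $u\in H$, $\|(id\hat{\otimes}_2\epsilon_{\lambda})(\mu^{\dagger}(u))-u\otimes1\|_{H\hat{\otimes}_2\mathbb{C}}\to0$. *)

(* Defs.v *)
From HB Require Import structures.
From mathcomp Require Import all_boot all_order all_algebra.
From mathcomp Require Import sesquilinear complex.
From mathcomp Require Import all_classical all_reals all_analysis.
Set Implicit Arguments.
Unset Strict Implicit.
Unset Printing Implicit Defensive.
Import Order.TTheory GRing.Theory Num.Theory.
Import numFieldNormedType.Exports.
Local Open Scope classical_set_scope.
Local Open Scope ring_scope.

HB.mixin Record isHilbert (R : realType) V of CompleteNormedModule R[i] V := {
  hdot : {dot V for (@Num.conj R[i])};
  hdot_norm : forall x : V, `|x| ^+ 2 = hdot x x
}.

#[short(type="hilbertType")]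
HB.structure Definition Hilbert (R : realType) :=
  {V of isHilbert R V & CompleteNormedModule R[i] V}.

(* The scalars as a Hilbert space.  The alias is needed because completeness  *)
(* of [K^o] is already registered, for [K : realType] only.                   *)
Definition complexn (R : realType) : Type := R[i]^o.

Section complexn_hilbert.
Variable R : realType.

HB.instance Definition _ := NormedModule.copy (complexn R) R[i]^o.

Lemma normc_ge_Im (z : R[i]) : `|complex.Im z|%:C%C <= `|z|.
Proof.
by case: z => a b; rewrite normc_def lecR -sqrtr_sqr ler_wsqrtr// lerDr sqr_ge0.
Qed.

Lemma normc_le_ReIm (z : R[i]) :
  `|z| <= (`|complex.Re z| + `|complex.Im z|)%:C%C.
Proof.
rewrite {1}[z]complexE (le_trans (ler_normD _ _))// rmorphD lerD//.
  by rewrite normc_def /= expr0n addr0 sqrtr_sqr.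
by rewrite normrM normc_def /= expr0n add0r expr1n sqrtr1 mul1r
  normc_def /= expr0n addr0 sqrtr_sqr.
Qed.

Lemma cauchy_coord (F : set_system (complexn R)) (p : complexn R -> R) :
  (forall z w, `|p z - p w|%:C%C <= `|z - w|) ->
  ProperFilter F -> cauchy F -> cvg (p @ F).
Proof.
move=> pB FF /cauchyP Fc; apply/cauchy_cvgP/cauchyP => e e0.
have [|z Fz] := Fc e%:C%C; first by rewrite ltcR.
exists (p z); suff : F (p @^-1` ball (p z) e) by [].
apply: filterS Fz => w; rewrite /preimage /= -!ball_normE /ball_ /= => zw.
by rewrite -ltcR; exact: le_lt_trans (pB _ _) zw.
Qed.

Lemma complexn_cauchy_cvg (F : set_system (complexn R)) :
  ProperFilter F -> cauchy F -> cvg F.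
Proof.
move=> FF Fc.
have /cvg_ex[/= a /cvgrPdist_lt Fa] : cvg ((@complex.Re R : complexn R -> R) @ F).
  apply: cauchy_coord => // z w.
  by apply: le_trans (normc_ge_Re _); rewrite (raddfB (@complex.Re R : {additive Rcomplex R -> R})).
have /cvg_ex[/= b /cvgrPdist_lt Fb] : cvg ((@complex.Im R : complexn R -> R) @ F).
  apply: cauchy_coord => // z w.
  by apply: le_trans (normc_ge_Im _); rewrite (raddfB (@complex.Im R : {additive Rcomplex R -> R})).
apply/cvg_ex; exists (a +i* b)%C; apply/cvgrPdist_lt => /= -[e e'].
rewrite ltcE /= => /andP[/eqP-> e0].
have e2 : 0 < e / 2 by rewrite divr_gt0.
near=> z; apply: le_lt_trans (normc_le_ReIm _) _.
rewrite ltcR [e]splitr ltrD//.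
  rewrite (raddfB (@complex.Re R : {additive Rcomplex R -> R})).
  by near: z; exact: Fa.
rewrite (raddfB (@complex.Im R : {additive Rcomplex R -> R})).
by near: z; exact: Fb.
Unshelve. all: by end_near. Qed.

HB.instance Definition _ :=
  Uniform_isComplete.Build (complexn R) complexn_cauchy_cvg.

Definition complexn_dot (x y : complexn R) : R[i] :=
  (x : R[i]) * Num.conj (y : R[i]).

Lemma complexn_dot_bilinear :
  bilinear_for (GRing.mul : GRing.Scale.law _ _)
    (@Num.conj R[i] \; *%R : GRing.Scale.law _ _) complexn_dot.
Proof.
split=> [y a u v|x a u v]; rewrite /complexn_dot /=.
  by rewrite mulrDl -mulrA.
by rewrite rmorphD rmorphM mulrDr mulrCA.
Qed.

HB.instance Definition _ :=
  bilinear_isBilinear.Build R[i] (complexn R) (complexn R) R[i] _ _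
    complexn_dot complexn_dot_bilinear.

Lemma complexn_dotC (x y : complexn R) :
  complexn_dot x y = (-1) ^+ false * Num.conj (complexn_dot y x).
Proof. by rewrite mul1r /complexn_dot rmorphM /= (@conjCK R[i]) mulrC. Qed.

HB.instance Definition _ :=
  isHermitianSesquilinear.Build R[i] (complexn R) false (@Num.conj R[i])
    complexn_dot complexn_dotC.

Lemma complexn_dot_gt0 (x : complexn R) : x != 0 -> 0 < complexn_dot x x.
Proof. by move=> x0; rewrite /complexn_dot -normCK exprn_gt0// normr_gt0. Qed.

HB.instance Definition _ :=
  isDotProduct.Build R[i] (complexn R) complexn_dot complexn_dot_gt0.

Lemma complexn_dot_norm (x : complexn R) : `|x| ^+ 2 = complexn_dot x x.
Proof. exact: normCK. Qed.

HB.instance Definition _ :=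
  isHilbert.Build R (complexn R) complexn_dot_norm.

End complexn_hilbert.

Section bounded_operators.
Variables (R : realType) (H K : hilbertType R).

Definition bounded_linear (f : H -> K) :=
  linear f /\ exists M : R[i], forall x, `|f x| <= M * `|x|.

(* [get] picks the operator with the stated property, which exists and is     *)
(* unique for bounded linear [f].                                             *)
Definition adjoint (f : H -> K) : K -> H :=
  get [set g | forall x y, hdot (f x) y = hdot x (g y)].

End bounded_operators.

(* A Hilbert tensor product of [H] and [K]: unique up to the unitary that     *)
(* matches the pure tensors.  Pure tensors are stable under scaling, so their *)
(* linear span is the set of their finite sums.                               *)
Record hilbertTensor (R : realType) (H K : hilbertType R) := HilbertTensor {
  tensor_space :> hilbertType R;
  tensor : {bilinear H -> K -> tensor_space};
  tensor_dot : forall x x' y y',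
    hdot (tensor x y) (tensor x' y') = hdot x x' * hdot y y';
  tensor_dense :
    closure [set t | exists s : seq (H * K), t = \sum_(p <- s) tensor p.1 p.2]
      = setT
}.

Arguments tensor {R H K} _.

(* [f (x) g], the only bounded linear map with the stated values.             *)
Definition tmap (R : realType) (H K H' K' : hilbertType R)
    (T : hilbertTensor H K) (T' : hilbertTensor H' K')
    (f : H -> H') (g : K -> K') : T -> T' :=
  get [set F : T -> T' | bounded_linear F /\
    forall x y, F (tensor T x y) = tensor T' (f x) (g y)].

Arguments tmap {R H K H' K'} T T' f g.

Section associator.
Variables (R : realType) (H : hilbertType R) (HH : hilbertTensor H H).
Variables (HH_H : hilbertTensor HH H) (H_HH : hilbertTensor H HH).

Definition tassoc : HH_H -> H_HH :=
  get [set F : HH_H -> H_HH | bounded_linear F /\ forall x y z,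
    F (tensor HH_H (tensor HH x y) z) = tensor H_HH x (tensor HH y z)].

Definition tassocV : H_HH -> HH_H :=
  get [set G : H_HH -> HH_H | cancel tassoc G /\ cancel G tassoc].

End associator.

Arguments tassoc {R H HH} HH_H H_HH.
Arguments tassocV {R H HH} HH_H H_HH.

Section frobenius.
Variables (R : realType) (H : hilbertType R) (HH : hilbertTensor H H).
Variables (HH_H : hilbertTensor HH H) (H_HH : hilbertTensor H HH).
Variable mu : HH -> H.

Definition hmul (x y : H) : H := mu (tensor HH x y).

Definition hilbertian_semigroup :=
  [/\ bounded_linear mu, associative hmul & commutative hmul].

Definition hilbertian_frobenius_semigroup :=
  [/\ hilbertian_semigroup,
      tmap HH_H HH mu idfun \o tassocV HH_H H_HH
        \o tmap HH H_HH idfun (adjoint mu) = adjoint mu \o mu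
    & adjoint mu \o mu = tmap H_HH HH idfun mu \o tassoc HH_H H_HH
        \o tmap HH HH_H (adjoint mu) idfun].

Definition special := mu \o adjoint mu = idfun.

End frobenius.

Section jacobson_radical.
Variables (R : realType) (H : hilbertType R) (op : H -> H -> H).

Definition is_ideal (I : set H) :=
  [/\ I 0, forall x y, I x -> I y -> I (x + y),
      forall (a : R[i]) x, I x -> I (a *: x)
    & forall x y, I x -> I (op x y) /\ I (op y x)].

Definition maximal_ideal (I : set H) :=
  [/\ is_ideal I, I <> setT
    & forall J, is_ideal J -> I `<=` J -> J = I \/ J = setT].

Definition modular_ideal (I : set H) :=
  is_ideal I /\ exists e, forall x, I (x - op x e) /\ I (x - op e x).

Definition jacobson_radical : set H :=
  \bigcap_(I in [set I | maximal_ideal I /\ modular_ideal I]) I.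

End jacobson_radical.

Definition semisimple (R : realType) (H : hilbertType R)
    (HH : hilbertTensor H H) (mu : HH -> H) :=
  jacobson_radical (hmul mu) = [set 0].

Record directed (L : Type) (le : L -> L -> Prop) : Prop := Directed {
  directed_inhabited : inhabited L;
  directed_refl : forall i, le i i;
  directed_trans : forall j i k, le i j -> le j k -> le i k;
  directed_ub : forall i j, exists k, le i k /\ le j k
}.

Definition net_tails (L : Type) (le : L -> L -> Prop) : set_system L :=
  filter_from setT (fun i => [set j | le i j]).

Section approximate.
Variables (R : realType) (H : hilbertType R) (HH : hilbertTensor H H).
Variables (HC : hilbertTensor H (complexn R)) (mu : HH -> H).

Definition has_approximate_unit :=
  exists (L : Type) (le : L -> L -> Prop) (e : L -> H), directed le /\
    forall u : H, (fun i => hmul mu u (e i)) @ net_tails le --> u.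

Definition has_approximate_counit :=
  exists (L : Type) (le : L -> L -> Prop) (eps : L -> H -> complexn R),
    [/\ directed le, forall i, bounded_linear (eps i)
      & forall u : H,
        (fun i => tmap HH HC idfun (eps i) (adjoint mu u)) @ net_tails le
          --> tensor HC u (1 : R[i])].

End approximate.

(* Main.v *)
From HB Require Import structures.
Require Import Defs.
From mathcomp Require Import all_boot all_order all_algebra.
From mathcomp Require Import sesquilinear complex ring lra.
From mathcomp Require Import all_classical all_reals all_analysis.
Set Implicit Arguments.
Unset Strict Implicit.
Unset Printing Implicit Defensive.
Import Order.TTheory GRing.Theory Num.Theory.
Import numFieldNormedType.Exports.
Local Open Scope classical_set_scope.
Local Open Scope ring_scope.

(** For x in H let L_x be the multiplication by x.  All the properties in the
    theorem are equivalent to the vanishing of the annihilator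
    Ann = {x | L_x = 0}, and all of them come from one consequence of the
    Frobenius law ([frobenius_normal]): the adjoint of L_y commutes with every
    L_z.  Thus the L_x form a commuting family of normal operators, and Ann, the
    common kernel of the L_x, is also the orthogonal complement of the products.

    Semisimplicity ([semisimple_annihilator]).  An annihilator is in every
    maximal modular ideal.  Conversely, if x is in the radical and y = x f, then
    L_y^* L_y is the multiplication by h = L_y^* y = x (L_y^* f), which is in the
    radical too, so all scalar multiples of h are quasi-regular.  But the norm of
    a positive operator belongs to its spectrum; so L_y = 0, for every f, and x
    is in Ann.  The spectral fact
    is an explicit estimate ([radical_annihilates_products]).

    Approximate units ([approximate_unit_iff]).  If u e_i tends to u then u is
    not a nonzero annihilator.  Conversely, given u_1, ..., u_n, the closure V of
    the subspace {(u_1 e, ..., u_n e)} of H^n is stable under all L_x and L_x^*,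
    so the component of (u_1, ..., u_n) orthogonal to V is annihilated by all
    L_x; if Ann = 0 it vanishes, and some e is almost a unit for all the u_i
    ([approximate_identity]).

    Approximate counits ([approximate_counit_iff]).  The functional <., e>
    applied to the second leg of the comultiplication of u gives L_e^* u (x) 1,
    and L_e^* u - u has the norm of L_e u - u by normality, so that approximate
    units give approximate counits.  An annihilator has comultiplication 0, so
    an approximate counit forces Ann = 0; and so does specialness.

    The operators f (x) g, the adjoints and the associator are specified by
    their values on pure tensors, and are only meaningful once they are known to
    exist.  This rests on a Riesz theorem for densely defined functionals
    ([riesz_graph]), which also yields the projection used above, and on a
    lifting criterion for bilinear maps that preserve orthogonality in one
    variable ([tensor_lift]). *)

(** * The real inner product underlying a complex Hilbert space *)

Section real_inner_product.
Variables (R : realType) (H : hilbertType R).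
Implicit Types (x y z : H) (a : R[i]) (k : R).

Definition rdot x y : R := complex.Re (hdot x y).
Definition sqn x : R := rdot x x.

Lemma ReD (a b : R[i]) : complex.Re (a + b) = complex.Re a + complex.Re b.
Proof. by case: a b => ? ? []. Qed.

Lemma hdot0l x : hdot 0 x = 0.
Proof. exact: linear0l. Qed.
Lemma hdot0r x : hdot x 0 = 0.
Proof. exact: linear0r. Qed.
Lemma hdotDl x y z : hdot (x + y) z = hdot x z + hdot y z.
Proof. exact: linearDl. Qed.
Lemma hdotDr x y z : hdot x (y + z) = hdot x y + hdot x z.
Proof. exact: linearDr. Qed.
Lemma hdotZl a x y : hdot (a *: x) y = a * hdot x y.
Proof. exact: linearZl_LR. Qed.
Lemma hdotZr a x y : hdot x (a *: y) = Num.conj a * hdot x y.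
Proof. exact: linearZr_LR. Qed.
Lemma hdotNl x y : hdot (- x) y = - hdot x y.
Proof. exact: linearNl. Qed.
Lemma hdotBl x y z : hdot (x - y) z = hdot x z - hdot y z.
Proof. exact: linearBl. Qed.
Lemma hdotBr x y z : hdot x (y - z) = hdot x y - hdot x z.
Proof. exact: linearBr. Qed.
Lemma hdotC x y : hdot x y = Num.conj (hdot y x).
Proof. by rewrite hermC /= expr0 mul1r. Qed.

Lemma hdot_sumr x I (r : seq I) (F : I -> H) :
  hdot x (\sum_(i <- r) F i) = \sum_(i <- r) hdot x (F i).
Proof. exact: linear_sumr. Qed.

Lemma hdot_suml x I (r : seq I) (F : I -> H) :
  hdot (\sum_(i <- r) F i) x = \sum_(i <- r) hdot (F i) x.
Proof. exact: linear_sumlz. Qed.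

Lemma hdot_sqn x : hdot x x = (sqn x)%:C%C.
Proof. by rewrite /sqn /rdot RRe_real// ger0_real// dnorm_ge0. Qed.

Lemma sqn_ge0 x : 0 <= sqn x.
Proof. by rewrite -ler0c -hdot_sqn dnorm_ge0. Qed.

Lemma sqn_eq0 x : sqn x = 0 -> x = 0.
Proof. by move=> x0; apply/eqP; rewrite -(dnorm_eq0 hdot) hdot_sqn x0. Qed.

Lemma rdotC x y : rdot x y = rdot y x.
Proof. by rewrite /rdot hdotC; case: (hdot y x). Qed.
Lemma rdotDl x y z : rdot (x + y) z = rdot x z + rdot y z.
Proof. by rewrite /rdot hdotDl ReD. Qed.
Lemma rdotZl k x y : rdot (k%:C%C *: x) y = k * rdot x y.
Proof.
by rewrite /rdot hdotZl; case: (hdot x y) => b c /=; rewrite mul0r subr0.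
Qed.
Lemma rdotDr x y z : rdot z (x + y) = rdot z x + rdot z y.
Proof. by rewrite rdotC rdotDl !(rdotC z). Qed.
Lemma rdotZr k x y : rdot x (k%:C%C *: y) = k * rdot x y.
Proof. by rewrite rdotC rdotZl rdotC. Qed.
Lemma rdotNl x y : rdot (- x) y = - rdot x y.
Proof. by rewrite /rdot hdotNl; case: (hdot x y). Qed.
Lemma rdotNr x y : rdot x (- y) = - rdot x y.
Proof. by rewrite rdotC rdotNl rdotC. Qed.

Lemma norm_sqn x : `|x| = (Num.sqrt (sqn x))%:C%C.
Proof.
apply/eqP; rewrite -(@eqrXn2 _ 2%N)// ?ler0c ?sqrtr_ge0// hdot_norm hdot_sqn.
by rewrite -rmorphXn /= sqr_sqrtr// sqn_ge0.
Qed.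

Lemma norm_lt x (e : R) : 0 < e -> (`|x| < e%:C%C) = (sqn x < e ^+ 2).
Proof.
move=> e0; rewrite norm_sqn ltcR -{1}(ger0_norm (ltW e0)) -sqrtr_sqr ltr_sqrt//.
by rewrite exprn_gt0.
Qed.

Lemma hdot_inj x y : (forall z, hdot z x = hdot z y) -> x = y.
Proof.
move=> h; apply/eqP; rewrite -subr_eq0; apply/eqP/sqn_eq0.
by rewrite /sqn /rdot hdotBr h subrr.
Qed.

Lemma sqnD x y : sqn (x + y) = sqn x + 2 * rdot x y + sqn y.
Proof. by rewrite /sqn rdotDl !rdotDr (rdotC y x); ring. Qed.
Lemma sqnN x : sqn (- x) = sqn x.
Proof. by rewrite /sqn rdotNl rdotNr opprK. Qed.
Lemma sqnB x y : sqn (x - y) = sqn x - 2 * rdot x y + sqn y.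
Proof. by rewrite sqnD rdotNr sqnN; ring. Qed.
Lemma sqnZ a x : (sqn (a *: x))%:C%C = `|a| ^+ 2 * (sqn x)%:C%C.
Proof. by rewrite -!hdot_sqn dnormZ. Qed.
Lemma sqnZr k x : sqn (k%:C%C *: x) = k ^+ 2 * sqn x.
Proof. by rewrite /sqn rdotZl rdotZr; ring. Qed.

Lemma sqnD_le x y : sqn (x + y) <= 2 * sqn x + 2 * sqn y.
Proof.
by have := sqn_ge0 (x - y); rewrite sqnB sqnD; set p := rdot x y; lra.
Qed.

Lemma sqn_small x : (forall e : R, 0 < e -> sqn x <= e) -> x = 0.
Proof.
move=> h; apply: sqn_eq0; apply/eqP; rewrite eq_le sqn_ge0 andbT.
by apply/ler_addgt0Pl => e e0; rewrite addr0 h.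
Qed.

(** Completeness of the complex norm, restated with the real square norm so that
    limits can be handled by inequalities between real numbers. *)
Lemma sqn_complete (u : nat -> H) :
    (forall e : R, 0 < e ->
      exists N, forall m n, (N <= m)%N -> (N <= n)%N -> sqn (u m - u n) < e) ->
  exists l, forall e : R, 0 < e ->
    exists N, forall n, (N <= n)%N -> sqn (u n - l) < e.
Proof.
move=> uc.
have cu : cauchy (u @ \oo).
  apply/cauchyP => -[e e'] /=; rewrite ltcE /= => /andP[/eqP -> e0].
  have [N HN] := uc _ (exprn_gt0 2 e0).
  exists (u N); exists N => // n /= Nn.
  rewrite /preimage/= -ball_normE /ball_ /=.
  by have -> : (e +i* 0)%C = e%:C%C by []; rewrite norm_lt// HN.
have /cvg_ex[/= l /cvgrPdist_lt ul] : cvg (u @ \oo) by exact: cauchy_cvg.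
exists l => e e0.
have se0 : 0 < Num.sqrt e by rewrite sqrtr_gt0.
have [|N _ HN] := ul (Num.sqrt e)%:C%C; first by rewrite ltcR.
exists N => n Nn; have := HN n Nn; rewrite /= norm_lt// sqr_sqrtr ?ltW//.
by rewrite -sqnN opprB.
Qed.

End real_inner_product.

(** The imaginary part of a complex inner product is the real part of another
    one, namely after scaling the left argument by i. *)
Lemma hdot_of_rdot (R : realType) (H K : hilbertType R) (x y : H) (u v : K) :
  (forall a, rdot (a *: x) y = rdot (a *: u) v) -> hdot x y = hdot u v.
Proof.
move=> h; have := h 1; have := h 'i%C; rewrite /rdot !hdotZl.
case: (hdot x y) => p q; case: (hdot u v) => r s /=.
by rewrite !(mul0r, mul1r, sub0r, subr0) => /oppr_inj -> ->.
Qed.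

(** * Riesz representation for densely defined functionals *)

Section riesz.
Variable R : realType.

(** A nonnegative real quadratic polynomial has nonpositive
    discriminant; the degenerate case q = 0 forces b = 0. *)
Lemma quad_discr (e b q : R) : 0 <= q ->
  (forall t, 0 <= e + 2 * t * b + t ^+ 2 * q) -> b ^+ 2 <= e * q.
Proof.
move=> q0 h; have [q00|qN0] := eqVneq q 0.
  rewrite q00 mulr0; have [->|b0] := eqVneq b 0; first by rewrite expr0n.
  have := h (- (e + 1) / (2 * b)); rewrite q00 mulr0 addr0.
  have -> : e + 2 * (- (e + 1) / (2 * b)) * b = -1 by field.
  by rewrite ler0N1.
have qp : 0 < q by rewrite lt_def qN0.
have := h (- b / q).
have -> : e + 2 * (- b / q) * b + (- b / q) ^+ 2 * q = (e * q - b ^+ 2) / q.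
  by field.
by rewrite pmulr_lge0 ?invr_gt0// subr_ge0.
Qed.

Variables (H : hilbertType R) (I : finType).
Implicit Types (v w : I -> H) (a b k : R).

Local Notation P v w := (\sum_i rdot (v i) (w i)).
Local Notation Q v := (\sum_i sqn (v i)).
Local Notation comb k v w := (fun i => v i + k%:C%C *: w i).

Lemma sumQ_ge0 v : 0 <= Q v.
Proof. by apply: sumr_ge0 => i _; exact: sqn_ge0. Qed.

Lemma sumQ_comb k v w : Q (comb k v w) = Q v + 2 * k * P v w + k ^+ 2 * Q w.
Proof.
rewrite !mulr_sumr -!big_split/=; apply: eq_bigr => i _.
by rewrite sqnD rdotZr sqnZr mulrA.
Qed.

Lemma sumP_comb k u v w : P (comb k v w) u = P v u + k * P w u.
Proof.
rewrite mulr_sumr -big_split/=; apply: eq_bigr => i _.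
by rewrite rdotDl rdotZl.
Qed.

Lemma sum_CauchySchwarz v w : P v w ^+ 2 <= Q v * Q w.
Proof.
apply: quad_discr; first exact: sumQ_ge0.
by move=> t; rewrite -sumQ_comb; exact: sumQ_ge0.
Qed.

Lemma sumQ_coord i v : sqn (v i) <= Q v.
Proof.
by rewrite (bigD1 i)//= lerDl; apply: sumr_ge0 => j _; exact: sqn_ge0.
Qed.

(** The functional is given by its graph D, a real subspace of pairs (v, a) with
    v in the finite power of H indexed by I, so that it may be defined on a mere
    subspace and its well-definedness need not be shown beforehand.  The
    representing vector l minimises J(v, a) = |v|^2 - 2 a: with v_n a minimising
    sequence, J(v_n + t w, a_n + t b) >= inf J for all real t bounds
    |<v_n, w> - b|^2 by (J(v_n) - inf J) |w|^2.  Applied to the differences of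
    the v_n this shows that they form a Cauchy sequence, and in the limit it
    gives <l, w> = b.  With a = <v, u> one gets the orthogonal projection of u,
    with a one-element index set the Riesz representation theorem. *)
Lemma riesz_graph (D : (I -> H) -> R -> Prop) (c : R) :
    D (fun=> 0) 0 ->
    (forall k v w a b, D v a -> D w b -> D (comb k v w) (a + k * b)) ->
    0 <= c -> (forall v a, D v a -> a ^+ 2 <= c * Q v) ->
  exists l : I -> H, [/\
    forall e : R, 0 < e -> exists v a, D v a /\ Q (comb (-1) v l) < e,
    forall v a, D v a -> a = P l v
  & Q l <= c].
Proof.
move=> D0 Dcomb c0 Dc.
pose J v a := Q v - 2 * a.
have JC v a : D v a -> - c <= J v a.
  move=> /Dc h; rewrite /J; have := sumQ_ge0 v; set q := Q v in h * => q0.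
  have : (2 * a) ^+ 2 <= (q + c) ^+ 2 by have := sqr_ge0 (q - c); nra.
  by rewrite leNgt => h2; rewrite leNgt; apply: contraNN h2 => h2; nra.
pose A := [set J va.1 va.2 | va in [set va : (I -> H) * R | D va.1 va.2]].
have Alb : has_lbound A.
  by exists (- c) => _ [[v a] /= /JC h <-].
have hA : has_inf A by split => //; exists (J (fun=> 0) 0); exists (fun=> 0, 0).
pose m := inf A.
have mJ v a : D v a -> m <= J v a.
  by move=> h; apply: ge_inf => //; exists (v, a).
have /choice [va vaP] : forall n : nat, exists va : (I -> H) * R,
    D va.1 va.2 /\ J va.1 va.2 < m + n.+1%:R^-1.
  move=> n; have [|_ [[v a] /= Dv <-] lt] := @inf_adherent _ A n.+1%:R^-1 _ hA.
    by rewrite invr_gt0 ltr0n.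
  by exists (v, a).
pose v n := (va n).1; pose a n := (va n).2; pose d n : R := n.+1%:R^-1.
have vD n : D (v n) (a n) by case: (vaP n).
have d0 n : 0 < d n by rewrite invr_gt0 ltr0n.
(* the vanishing of the first variation, up to the defect d n of v n *)
have key n w b : D w b -> (P (v n) w - b) ^+ 2 <= d n * Q w.
  move=> Dw; apply: quad_discr; first exact: sumQ_ge0.
  move=> t; have := mJ _ _ (Dcomb t _ _ _ _ (vD n) Dw).
  have [_] := vaP n; rewrite /J sumQ_comb -/(v n) -/(a n) -/(d n).
  nra.
have vv j (k : nat) : Q (comb (-1) (v j) (v k)) <= 2 * d j + 2 * d k.
  pose w := comb (-1) (v j) (v k); rewrite -[leLHS]/(Q w); have Dw := Dcomb (-1) _ _ _ _ (vD j) (vD k).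
  have := key j _ _ Dw; have := key k _ _ Dw; rewrite -/w.
  have : P w w = P (v j) w + -1 * P (v k) w by rewrite -sumP_comb.
  rewrite -/(Q w); set b := (a j + _); set x := P (v j) w; set y := P (v k) w.
  have := sumQ_ge0 w; set q := Q w.
  move=> q0 qE h1 h2.
  have h3 : q ^+ 2 <= (2 * d j + 2 * d k) * q.
    have -> : q ^+ 2 = (x - y) ^+ 2 by rewrite qE mulN1r.
    by have := sqr_ge0 ((x - b) + (y - b)); nra.
  have [->|qn0] := eqVneq q 0; first by have := d0 j; have := d0 k; lra.
  have qp : 0 < q by rewrite lt_def qn0.
  by rewrite -(ler_pM2r qp) -expr2.
have dsmall (e : R) : 0 < e -> exists N, forall n, (N <= n)%N -> d n < e.
  move=> e0; exists (Num.trunc e^-1).+1 => n Nn.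
  rewrite /d invf_plt ?posrE ?ltr0n//.
  apply: (lt_le_trans (truncnS_gt _)); rewrite ler_nat.
  by apply: leq_trans Nn _.
have /choice [l lP] : forall i, exists li : H, forall e : R, 0 < e ->
    exists N, forall n, (N <= n)%N -> sqn (v n i - li) < e.
  move=> i; apply: (sqn_complete (u := fun n => v n i)) => e e0.
  have [|N HN] := dsmall (e / 4); first by rewrite divr_gt0.
  exists N => j p Nj Np.
  have -> : v j i - v p i = comb (-1) (v j) (v p) i by rewrite rmorphN1 scaleN1r.
  apply: le_lt_trans (sumQ_coord i (comb (-1) (v j) (v p))) _.
  by apply: le_lt_trans (vv j p) _; have := HN _ Nj; have := HN _ Np; lra.
have lQ (e : R) : 0 < e ->
    exists N, forall n, (N <= n)%N -> Q (comb (-1) (v n) l) < e.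
  move=> e0; pose e' := e / #|I|.+1%:R.
  have e'0 : 0 < e' by rewrite divr_gt0.
  have /choice [N HN] := fun i => lP i e' e'0.
  exists (\max_i N i) => n Nn.
  apply: (@le_lt_trans _ _ (\sum_(i : I) e')).
    apply: ler_sum => i _; rewrite rmorphN1 scaleN1r ltW// HN//.
    by apply: leq_trans Nn; exact: (leq_bigmax (F := N)).
  rewrite sumr_const -mulr_natr /e' mulrAC -mulrA gtr_pMr//.
  by rewrite ltr_pdivrMr ?ltr0n// mul1r ltr_nat.
have lD w b : D w b -> b = P l w.
  move=> Dw; apply/eqP; rewrite eq_sym -subr_eq0 -sqrf_eq0 eq_le sqr_ge0 andbT.
  apply/ler_addgt0Pl => e e0; rewrite addr0.
  pose q := Q w; have q0 : 0 <= q := sumQ_ge0 w.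
  pose e' := e / (4 * (q + 1)).
  have e'0 : 0 < e' by rewrite divr_gt0// mulr_gt0// ltr_wpDl.
  have [N1 H1] := lQ _ e'0; have [N2 H2] := dsmall _ e'0.
  pose n := maxn N1 N2.
  pose Ql := Q (comb (-1) (v n) l).
  have {}H1 : Ql < e' := H1 n (leq_maxl _ _); have {}H2 := H2 n (leq_maxr _ _).
  have h1 := key n _ _ Dw.
  have : _ <= Ql * q := sum_CauchySchwarz (comb (-1) (v n) l) w.
  rewrite sumP_comb; rewrite -/q in h1; set x := P (v n) w in h1 *; set y := P l w => h2.
  have ee : e = 4 * e' * (q + 1).
    by rewrite /e'; field; rewrite gt_eqF// ltr_wpDl.
  have := sqr_ge0 ((x - b) + (x - y)); nra.
exists l; split => //.
  by move=> e /lQ [N /(_ N (leqnn _)) h]; exists (v N), (a N).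
apply/ler_addgt0Pl => e /lQ [N /(_ N (leqnn _))].
have := JC _ _ (vD N); rewrite /J (lD _ _ (vD N)) sumQ_comb.
have -> : P l (v N) = P (v N) l by apply: eq_bigr => i _; exact: rdotC.
lra.
Qed.

End riesz.

(** * Bounded operators and their adjoints *)

Section bounded.
Variables (R : realType).
Implicit Types (H K L : hilbertType R).

Lemma rdot_CauchySchwarz H (x y : H) : rdot x y ^+ 2 <= sqn x * sqn y.
Proof.
apply: quad_discr; first exact: sqn_ge0.
by move=> t; have := sqn_ge0 (x + t%:C%C *: y); rewrite sqnD rdotZr sqnZr mulrA.
Qed.

(** Scaling x by the conjugate of <x, y> makes the inner product real, which
    reduces the claim to its real version. *)
Lemma hdot_CauchySchwarz H (x y : H) :
  `|hdot x y| ^+ 2 <= (sqn x * sqn y)%:C%C.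
Proof.
set a := hdot x y; pose q := complex.Re (`|a| ^+ 2).
have aq : `|a| ^+ 2 = q%:C%C by rewrite RRe_real// ger0_real// exprn_ge0.
have q0 : 0 <= q by rewrite -ler0c -aq exprn_ge0.
rewrite aq lecR; have [->|qn0] := eqVneq q 0.
  by rewrite mulr_ge0 ?sqn_ge0.
have qp : 0 < q by rewrite lt_def qn0.
rewrite -(ler_pM2l qp) -expr2 mulrA.
have <- : sqn (Num.conj a *: x) = q * sqn x.
  by apply: complexI; rewrite sqnZ norm_conjC aq rmorphM.
have {1}-> : q = rdot (Num.conj a *: x) y.
  by rewrite /rdot hdotZl -/a mulrC -normCK.
exact: rdot_CauchySchwarz.
Qed.

Lemma riesz_dense H (D : H -> R -> Prop) (c : R) :
    D 0 0 ->
    (forall k v w a b, D v a -> D w b -> D (v + k%:C%C *: w) (a + k * b)) ->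
    0 <= c -> (forall v a, D v a -> a ^+ 2 <= c * sqn v) ->
  exists l : H, (forall v a, D v a -> a = rdot l v) /\ sqn l <= c.
Proof.
move=> D0 Dcomb c0 Dc.
have [||||l [_ lD lc]] := @riesz_graph _ H 'I_1 (fun v => D (v ord0)) c.
- exact: D0.
- by move=> k v w a b; exact: Dcomb.
- exact: c0.
- by move=> v a Dva; rewrite big_ord1; exact: Dc.
exists (l ord0); split; last by move: lc; rewrite big_ord1.
by move=> v a /(lD (fun=> v)); rewrite big_ord1.
Qed.

Lemma linearD_fun (U V : lmodType R[i]) (f : U -> V) (x y : U) :
  linear f -> f (x + y) = f x + f y.
Proof. by move=> fl; have := fl 1 x y; rewrite !scale1r. Qed.

Lemma linear0_fun (U V : lmodType R[i]) (f : U -> V) : linear f -> f 0 = 0.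
Proof. by move=> fl; apply: (addrI (f 0)); rewrite -(linearD_fun _ _ fl) !addr0. Qed.

Lemma linearZ_fun (U V : lmodType R[i]) (f : U -> V) a (x : U) :
  linear f -> f (a *: x) = a *: f x.
Proof. by move=> fl; have := fl a x 0; rewrite (linear0_fun fl) !addr0. Qed.

Lemma linearB_fun (U V : lmodType R[i]) (f : U -> V) (x y : U) :
  linear f -> f (x - y) = f x - f y.
Proof.
by move=> fl; rewrite (linearD_fun _ _ fl) -scaleN1r (linearZ_fun _ _ fl) scaleN1r.
Qed.

(** Bounds between square norms involve real constants only, whereas the constant
    in the definition of boundedness is any complex number. *)
Lemma bounded_sqn H K (f : H -> K) : bounded_linear f ->
  exists c : R, 0 <= c /\ forall x, sqn (f x) <= c * sqn x.
Proof.
case=> _ [M fM].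
exists (complex.Re (`|M| ^+ 2)).
have ME : `|M| ^+ 2 = (complex.Re (`|M| ^+ 2))%:C%C.
  by rewrite RRe_real// ger0_real// exprn_ge0.
have M0 : 0 <= complex.Re (`|M| ^+ 2) by rewrite -ler0c -ME exprn_ge0.
split=> // x; rewrite -lecR rmorphM /= -ME -!hdot_sqn -!hdot_norm -exprMn.
rewrite ler_sqr ?nnegrE ?mulr_ge0//.
have Mx : `|M * `|x| | = `|M| * `|x| by rewrite normrM normr_id.
by rewrite -Mx (le_trans (fM x))// real_ler_norm// ger0_real// (le_trans _ (fM x)).
Qed.

Lemma sqn_bounded H K (f : H -> K) (c : R) : linear f ->
  (forall x, sqn (f x) <= c * sqn x) -> bounded_linear f.
Proof.
move=> fl fc; split=> //; exists (Num.sqrt (Num.max c 0))%:C%C => x.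
rewrite !norm_sqn -rmorphM lecR -sqrtrM ?le_max ?lexx ?orbT//.
apply: ler_wsqrtr; apply: le_trans (fc x) _.
by rewrite ler_wpM2r ?sqn_ge0// le_max lexx.
Qed.

Lemma adjointP H K (f : H -> K) : bounded_linear f ->
  forall x y, hdot (f x) y = hdot x (adjoint f y).
Proof.
move=> fb; rewrite /adjoint; set S := [set g | _].
suff /getPex : exists g, S g by [].
have [c [c0 fc]] := bounded_sqn fb; case: fb => fl _.
suff /choice [g gP] : forall y, exists z, forall x, hdot (f x) y = hdot x z.
  by exists g => x y; exact: gP.
move=> y.
pose D v a := a = rdot (f v) y.
have [||||z [zD _]] := @riesz_dense H D (c * sqn y).
- by rewrite /D (linear0_fun fl) /rdot linear0l.
- move=> k v w a b; rewrite /D => -> ->.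
  by rewrite (linearD_fun _ _ fl) (linearZ_fun _ _ fl) rdotDl rdotZl.
- by rewrite mulr_ge0// sqn_ge0.
- move=> v a ->; apply: le_trans (rdot_CauchySchwarz _ _) _.
  by rewrite mulrAC ler_wpM2r ?sqn_ge0.
exists z => x; apply: hdot_of_rdot => a.
by rewrite -(linearZ_fun _ _ fl) (rdotC _ z); exact: zD.
Qed.

Lemma adjoint_linear H K (f : H -> K) : bounded_linear f -> linear (adjoint f).
Proof.
move=> fb a x y; apply: hdot_inj => z.
by rewrite -adjointP// !(hdotDr, hdotZr) !adjointP.
Qed.

Lemma adjoint_sqn H K (f : H -> K) c : bounded_linear f -> 0 <= c ->
  (forall x, sqn (f x) <= c * sqn x) -> forall y, sqn (adjoint f y) <= c * sqn y.
Proof.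
move=> fb c0 fc y; set g := adjoint f y.
have [->|qn0] := eqVneq (sqn g) 0; first by rewrite mulr_ge0// sqn_ge0.
have qp : 0 < sqn g by rewrite lt_def qn0 sqn_ge0.
rewrite -(ler_pM2r qp) -expr2.
have {1}-> : sqn g = rdot (f g) y by rewrite /rdot adjointP.
apply: le_trans (rdot_CauchySchwarz _ _) _.
by rewrite mulrAC ler_wpM2r ?sqn_ge0.
Qed.

Lemma adjoint_bounded H K (f : H -> K) :
  bounded_linear f -> bounded_linear (adjoint f).
Proof.
move=> fb; have [c [c0 fc]] := bounded_sqn fb.
by apply: sqn_bounded (adjoint_linear fb) (adjoint_sqn fb c0 fc).
Qed.

End bounded.

(** * Lifting bilinear maps to the Hilbert tensor product *)

Section tensor_facts.
Variables (R : realType).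
Implicit Types (H K L : hilbertType R).

Definition bilin H K L (B : H -> K -> L) :=
  (forall y, linear (B^~ y)) /\ (forall x, linear (B x)).

Lemma tensor_bilin H K (T : hilbertTensor H K) : bilin (tensor T).
Proof. by split=> [y|x] a u v; [exact: linearPl|exact: linearPr]. Qed.

Lemma tensor_sqn H K (T : hilbertTensor H K) x y :
  sqn (tensor T x y) = sqn x * sqn y.
Proof.
by apply: complexI; rewrite -hdot_sqn tensor_dot !hdot_sqn rmorphM.
Qed.

Lemma tensor_approx H K (T : hilbertTensor H K) (t : T) (e : R) : 0 < e ->
  exists s : seq (H * K), sqn (t - \sum_(p <- s) tensor T p.1 p.2) < e.
Proof.
move=> e0; have : [set: T] t by [].
have se0 : 0 < Num.sqrt e by rewrite sqrtr_gt0.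
rewrite -(tensor_dense T) => /(_ (ball t (Num.sqrt e)%:C%C)) [].
  by apply: nbhsx_ballx; rewrite ltcR.
move=> _ [[s ->]]; rewrite -ball_normE /ball_ /= norm_lt// sqr_sqrtr ?ltW//.
by exists s.
Qed.

(** How density of the pure tensors is used: every identity between vectors of a
    tensor product is tested against pure tensors. *)
Lemma tensor_orth H K (T : hilbertTensor H K) (z : T) :
  (forall x y, hdot (tensor T x y) z = 0) -> z = 0.
Proof.
move=> zT; apply: sqn_small => e /(tensor_approx z) [s /ltW].
apply: le_trans; rewrite sqnB (rdotC z) /rdot hdot_suml big1 => [|p _] //=.
by rewrite mulr0 subr0 lerDl sqn_ge0.
Qed.

Lemma tensor_map0 H K L (T : hilbertTensor H K) (f : T -> L) :
  bounded_linear f -> (forall x y, f (tensor T x y) = 0) -> forall t, f t = 0.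
Proof.
move=> fb f0 t; apply: hdot_inj => l.
rewrite hdot0r hdotC adjointP// (_ : adjoint f l = 0) ?hdot0r ?rmorph0//.
by apply: tensor_orth => x y; rewrite -adjointP// f0 hdot0l.
Qed.

Fact flip_tensor_bilinear H K (T : hilbertTensor H K) :
  bilinear_for (GRing.Scale.Law.clone _ _ *:%R _)
    (GRing.Scale.Law.clone _ _ *:%R _) (fun y x => tensor T x y).
Proof. by split=> [x|y] a u v; [exact: linearPr|exact: linearPl]. Qed.

(** Exchanging the factors turns statements on f (x) id into statements on
    id (x) f. *)
Definition flip_tensor H K (T : hilbertTensor H K) : hilbertTensor K H.
Proof.
pose b := bilinear_isBilinear.Build R[i] K H T _ _ _ (flip_tensor_bilinear T).
pose B : {bilinear K -> H -> T} := HB.pack (fun y x => tensor T x y) b.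
apply: (@HilbertTensor R K H T B) => [y y' x x'|].
  by rewrite tensor_dot mulrC.
rewrite -(tensor_dense T); congr closure; apply/seteqP; split => _ [s ->];
  by exists [seq (p.2, p.1) | p <- s]; rewrite big_map.
Defined.

Definition ortho H (x y : H) := hdot x y == 0.

(** One Gram-Schmidt step on the second legs.  Subtracting from y a multiple c v
    of the second leg v of a term u (x) v changes x (x) y by c x (x) v, which that
    term absorbs when u becomes u + c x; the second legs of the list therefore do
    not change.  The identity is asserted for all bilinear maps at once because
    the list s' must not depend on them. *)
Lemma orthogonalize_head H K (s : seq (H * K)) (x : H) (y : K) :
    pairwise (@ortho K) [seq p.2 | p <- s] ->
  exists y' (s' : seq (H * K)), [/\ [seq p.2 | p <- s'] = [seq p.2 | p <- s],
    all (@ortho K y') [seq p.2 | p <- s]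
  & forall L (B : H -> K -> L), bilin B ->
      B x y + \sum_(p <- s) B p.1 p.2 = B x y' + \sum_(p <- s') B p.1 p.2].
Proof.
elim: s => [_|[u v] s ih] /=.
  by exists y, [::].
case/andP => vs /ih [y' [s' [s's ys' sum]]].
pose c := hdot y' v / hdot v v.
exists (y' - c *: v), ((u + c *: x, v) :: s'); split => /=.
- by rewrite s's.
- apply/andP; split.
    rewrite /ortho hdotBl hdotZl /c; have [->|v0] := eqVneq v 0.
      by rewrite !hdot0r mulr0 subrr.
    by rewrite divfK ?subrr// (dnorm_eq0 hdot).
  apply/allP => w ws; rewrite /ortho hdotBl hdotZl.
  by rewrite (eqP (allP ys' _ ws)) (eqP (allP vs _ ws)) mulr0 subrr.
move=> L B Bb; rewrite !big_cons /= addrCA sum//; case: Bb => Bl Br.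
rewrite (linearD_fun _ _ (Bl v)) (linearZ_fun _ _ (Bl v)).
rewrite (linearB_fun _ _ (Br x)) (linearZ_fun _ _ (Br x)).
by rewrite (addrC (B u v) (c *: _)) -(addrA (c *: _)) subrKA addrCA.
Qed.

Lemma orthogonalize H K (s : seq (H * K)) :
  exists s' : seq (H * K), pairwise (@ortho K) [seq p.2 | p <- s'] /\
    forall L (B : H -> K -> L), bilin B ->
      \sum_(p <- s) B p.1 p.2 = \sum_(p <- s') B p.1 p.2.
Proof.
elim: s => [|[x y] s [s1 [s1o s1s]]]; first by exists [::].
have [y' [s' [s's ys' sum]]] := orthogonalize_head x y s1o.
exists ((x, y') :: s'); split; first by rewrite /= s's ys'.
by move=> L B Bb; rewrite !big_cons /= s1s// sum.
Qed.

Lemma sqn_ortho_sum H K L (B : H -> K -> L) (s : seq (H * K)) :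
    (forall x x' y y', hdot y y' = 0 -> hdot (B x y) (B x' y') = 0) ->
    pairwise (@ortho K) [seq p.2 | p <- s] ->
  sqn (\sum_(p <- s) B p.1 p.2) = \sum_(p <- s) sqn (B p.1 p.2).
Proof.
move=> Bo; elim: s => [|p s ih] /=.
  by rewrite !big_nil /sqn /rdot hdot0l.
case/andP => ps /ih {ih}ih; rewrite !big_cons sqnD ih /rdot hdot_sumr.
rewrite big_seq big1 ?mulr0 ?addr0// => q qs.
by apply: Bo; apply/eqP/(allP ps)/map_f.
Qed.

(** After orthogonalisation of the second legs both sides are sums of squares,
    by Pythagoras, and can be compared term by term. *)
Lemma tensor_sum_bound H K L (T : hilbertTensor H K) (B : H -> K -> L) c
    (s : seq (H * K)) :
    bilin B ->
    (forall x x' y y', hdot y y' = 0 -> hdot (B x y) (B x' y') = 0) ->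
    (forall x y, sqn (B x y) <= c * (sqn x * sqn y)) ->
  sqn (\sum_(p <- s) B p.1 p.2) <= c * sqn (\sum_(p <- s) tensor T p.1 p.2).
Proof.
move=> Bb Bo Bc; have [s' [s'o s's]] := orthogonalize s.
rewrite !s's//; last exact: tensor_bilin.
rewrite !sqn_ortho_sum// => [|x x' y y' yy']; last first.
  by rewrite tensor_dot yy' mulr0.
by rewrite mulr_sumr ler_sum// => p _; rewrite tensor_sqn.
Qed.

(** A bounded bilinear map need not extend to the Hilbert tensor product; it does
    when it preserves orthogonality in the second variable.  For each l the
    functional x (x) y |-> <B x y, l> on the span of the pure tensors is
    represented by a vector G l, and the extension of B is the adjoint of G. *)
Lemma tensor_lift H K L (T : hilbertTensor H K) (B : H -> K -> L) c :
    0 <= c -> bilin B ->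
    (forall x x' y y', hdot y y' = 0 -> hdot (B x y) (B x' y') = 0) ->
    (forall x y, sqn (B x y) <= c * (sqn x * sqn y)) ->
  exists F : T -> L, [/\ bounded_linear F, forall x y, F (tensor T x y) = B x y
    & forall t, sqn (F t) <= c * sqn t].
Proof.
move=> c0 Bb Bo Bc.
have /choice [G GP] : forall l, exists z : T,
    (forall x y, hdot (tensor T x y) z = hdot (B x y) l) /\ sqn z <= c * sqn l.
  move=> l.
  pose D (t : T) a := exists s : seq (H * K), t = \sum_(p <- s) tensor T p.1 p.2
    /\ a = rdot (\sum_(p <- s) B p.1 p.2) l.
  have [||||z [zD zc]] := @riesz_dense R T D (c * sqn l).
  - by exists [::]; rewrite !big_nil /rdot hdot0l.
  - move=> k v w a b [s [-> ->]] [s' [-> ->]].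
    exists (s ++ [seq (k%:C%C *: p.1, p.2) | p <- s']).
    rewrite !big_cat !big_map /= rdotDl -rdotZl !scaler_sumr.
    split; congr (_ + _).
      by apply: eq_bigr => p _; rewrite linearZl_LR.
    congr rdot; apply: eq_bigr => p _.
    by rewrite (linearZ_fun _ _ (Bb.1 _)).
  - by rewrite mulr_ge0// sqn_ge0.
  - move=> v a [s [-> ->]]; apply: le_trans (rdot_CauchySchwarz _ _) _.
    rewrite mulrAC ler_wpM2r ?sqn_ge0//.
    exact: tensor_sum_bound.
  exists z; split => // x y; apply: hdot_of_rdot => a.
  rewrite -linearZl_LR -(linearZ_fun _ _ (Bb.1 _)) rdotC; apply/esym/zD.
  by exists [:: (a *: x, y)]; rewrite !big_seq1.
have Gl : linear G.
  move=> a l l'; apply/eqP; rewrite -subr_eq0; apply/eqP.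
  apply: (@tensor_orth H K T) => x y; rewrite hdotBr hdotDr hdotZr.
  by rewrite !(GP _).1 hdotDr hdotZr subrr.
have Gc l : sqn (G l) <= c * sqn l by case: (GP l).
have Gb := sqn_bounded Gl Gc.
exists (adjoint G); split; first exact: adjoint_bounded.
  move=> x y; apply: hdot_inj => l; rewrite -adjointP//.
  by rewrite hdotC (GP l).1 -hdotC.
exact: adjoint_sqn.
Qed.

End tensor_facts.

(** * Tensor products of operators and the associator *)

Section tensor_maps.
Variables (R : realType).
Implicit Types (H K L : hilbertType R).

Lemma bounded_linear_comp H K L (f : H -> K) (g : K -> L) :
  bounded_linear f -> bounded_linear g -> bounded_linear (g \o f).
Proof.
move=> fb gb; have [c [c0 fc]] := bounded_sqn fb.
have [d [d0 gd]] := bounded_sqn gb; case: fb gb => fl _ [gl _].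
apply: (@sqn_bounded _ _ _ _ (d * c)) => [a x y|x] /=.
  by rewrite fl gl.
by apply: le_trans (gd _) _; rewrite -mulrA ler_wpM2l.
Qed.

Lemma tensor_map_l H K H' (T : hilbertTensor H K) (T' : hilbertTensor H' K)
    (f : H -> H') c : linear f -> 0 <= c -> (forall x, sqn (f x) <= c * sqn x) ->
  exists F : T -> T', [/\ bounded_linear F,
    forall x y, F (tensor T x y) = tensor T' (f x) y
    & forall t, sqn (F t) <= c * sqn t].
Proof.
move=> fl c0 fc; apply: tensor_lift => //.
- split=> [y|x] a u v; last exact: linearPr.
  by rewrite fl linearPl.
- by move=> x x' y y' yy'; rewrite tensor_dot yy' mulr0.
- by move=> x y; rewrite tensor_sqn mulrA ler_wpM2r// sqn_ge0.
Qed.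

Lemma tensor_map_r H K K' (T : hilbertTensor H K) (T' : hilbertTensor H K')
    (g : K -> K') c : linear g -> 0 <= c -> (forall x, sqn (g x) <= c * sqn x) ->
  exists F : T -> T', [/\ bounded_linear F,
    forall x y, F (tensor T x y) = tensor T' x (g y)
    & forall t, sqn (F t) <= c * sqn t].
Proof.
move=> gl c0 gc.
have [F [Fb FE Fc]] := tensor_map_l (flip_tensor T) (flip_tensor T') gl c0 gc.
by exists F; split=> // x y; exact: (FE y x).
Qed.

Lemma tmap_lP H K H' (T : hilbertTensor H K) (T' : hilbertTensor H' K)
    (f : H -> H') : bounded_linear f ->
  bounded_linear (tmap T T' f idfun) /\
  forall x y, tmap T T' f idfun (tensor T x y) = tensor T' (f x) y.
Proof.
move=> fb; have [c [c0 fc]] := bounded_sqn fb.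
have [F [Fb FE _]] := tensor_map_l T T' fb.1 c0 fc.
rewrite /tmap; set S := [set F | _].
have /getPex : exists F, S F by exists F.
by [].
Qed.

Lemma tmap_rP H K K' (T : hilbertTensor H K) (T' : hilbertTensor H K')
    (g : K -> K') : bounded_linear g ->
  bounded_linear (tmap T T' idfun g) /\
  forall x y, tmap T T' idfun g (tensor T x y) = tensor T' x (g y).
Proof.
move=> gb; have [c [c0 gc]] := bounded_sqn gb.
have [F [Fb FE _]] := tensor_map_r T T' gb.1 c0 gc.
rewrite /tmap; set S := [set F | _].
have /getPex : exists F, S F by exists F.
by [].
Qed.

(** For each z the map x (x) y |-> x (x) (y (x) z) is id (x) (- (x) z), an operator F z
    on H (x) H.  The operators F z and F z' have orthogonal ranges when z and z' are
    orthogonal, so (t, z) |-> F z t lifts in turn to (H (x) H) (x) H. *)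
Lemma tassocP H (HH : hilbertTensor H H) (HH_H : hilbertTensor HH H)
    (H_HH : hilbertTensor H HH) :
  bounded_linear (tassoc HH_H H_HH) /\ forall x y z,
  tassoc HH_H H_HH (tensor HH_H (tensor HH x y) z)
    = tensor H_HH x (tensor HH y z).
Proof.
rewrite /tassoc; set S := [set F | _].
suff /getPex : exists F, S F by [].
have /choice [F FP] : forall z, exists F : HH -> H_HH, [/\ bounded_linear F,
    forall x y, F (tensor HH x y) = tensor H_HH x (tensor HH y z)
    & forall t, sqn (F t) <= sqn z * sqn t].
  move=> z; apply: (@tensor_map_r _ _ _ HH H_HH (fun y => tensor HH y z)).
  - by move=> a u v; exact: linearPl.
  - exact: sqn_ge0.
  - by move=> y; rewrite tensor_sqn mulrC.
have Fb z : bounded_linear (F z) by case: (FP z).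
have FE z x y : F z (tensor HH x y) = tensor H_HH x (tensor HH y z).
  by case: (FP z).
have [||||G [Gb GE _]] := @tensor_lift R HH H H_HH HH_H (fun t z => F z t) 1.
- by [].
- split=> [z|t]; first by case: (Fb z).
  move=> a z z'; apply: hdot_inj => l.
  rewrite hdotC [RHS]hdotC; congr Num.conj; rewrite hdotDl hdotZl !adjointP//.
  have -> : adjoint (F (a *: z + z')) l
      = Num.conj a *: adjoint (F z) l + adjoint (F z') l.
    apply/eqP; rewrite -subr_eq0; apply/eqP.
    apply: (@tensor_orth _ _ _ HH) => x y.
    rewrite hdotBr hdotDr hdotZr -!adjointP// !FE !linearPr.
    by rewrite hdotDl hdotZl conjCK subrr.
  by rewrite hdotDr hdotZr conjCK.
- move=> t t' z z' zz'; rewrite adjointP//.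
  rewrite (_ : adjoint (F z) (F z' t') = 0) ?hdot0r//.
  have := @tensor_map0 _ _ _ _ HH (adjoint (F z) \o F z'); apply.
    by apply: bounded_linear_comp => //; exact: adjoint_bounded.
  move=> x' y'; apply: (@tensor_orth _ _ _ HH) => x y /=.
  by rewrite -adjointP// !FE !tensor_dot zz' !mulr0.
- by move=> t z; rewrite mul1r mulrC; case: (FP z).
by exists G; split=> // x y z; rewrite GE FE.
Qed.

End tensor_maps.

(** * The Frobenius law as normality of the multiplications *)

(** What the Frobenius law says about the algebra alone: the adjoint of each
    multiplication commutes with all multiplications.  In particular each
    multiplication is a normal operator. *)
Record normal_multiplication (R : realType) (H : hilbertType R)
    (op : H -> H -> H) : Prop := NormalMultiplication {
  op_bounded : forall x, bounded_linear (op x);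
  opC : commutative op;
  opA : associative op;
  adjoint_op : forall x z w, adjoint (op x) (op z w) = op z (adjoint (op x) w)
}.

Section frobenius_normal.
Variables (R : realType) (H : hilbertType R) (HH : hilbertTensor H H).
Variables (HH_H : hilbertTensor HH H) (H_HH : hilbertTensor H HH).
Variable mu : HH -> H.

Lemma hmul_bounded : bounded_linear mu -> forall x, bounded_linear (hmul mu x).
Proof.
move=> mub x; have [c [c0 muc]] := bounded_sqn mub.
apply: (@sqn_bounded _ _ _ _ (c * sqn x)) => [a y z|y].
  by rewrite /hmul linearPr mub.1.
by apply: le_trans (muc _) _; rewrite tensor_sqn mulrA.
Qed.

Lemma hdot_adjoint (K L : hilbertType R) (f : K -> L) x y : bounded_linear f ->
  hdot y (f x) = hdot (adjoint f y) x.
Proof. by move=> fb; rewrite hdotC adjointP// -hdotC. Qed.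

(** Let delta be the adjoint of mu, alpha the associator and y^* the adjoint of
    the multiplication by y.  Testing delta mu = (id (x) mu) alpha (delta (x) id) on
    x (x) y against z (x) w gives
    <xy, zw> = <delta x, z (x) y^* w> = <x, z (y^* w)>;
    by commutativity the left side is also <x, y^* (z w)>. *)
Lemma frobenius_normal :
  hilbertian_frobenius_semigroup HH_H H_HH mu -> normal_multiplication (hmul mu).
Proof.
move=> [[mub muA muC] _ frob]; have hb := hmul_bounded mub.
split=> // y z w; apply: hdot_inj => x; rewrite -adjointP// (muC y x).
rewrite {1 2}/hmul hdot_adjoint// -[adjoint mu (mu _)]/((adjoint mu \o mu) _).
have db := adjoint_bounded mub.
have [tlb tlE] := tmap_lP HH HH_H db.
have [trb trE] := tmap_rP H_HH HH mub.
have [ab aE] := tassocP HH_H H_HH.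
rewrite frob /= tlE.
pose P t := tmap H_HH HH idfun mu (tassoc HH_H H_HH (tensor HH_H t y)).
have Pb : bounded_linear P.
  have -> : P = tmap H_HH HH idfun mu \o (tassoc HH_H H_HH \o (tensor HH_H ^~ y)).
    by [].
  apply: bounded_linear_comp => //; apply: bounded_linear_comp => //.
  apply: (@sqn_bounded _ _ _ _ (sqn y)) => [a t t'|t]; first exact: linearPl.
  by rewrite tensor_sqn mulrC.
have PE : adjoint P (tensor HH z w) = tensor HH z (adjoint (hmul mu y) w).
  apply/eqP; rewrite -subr_eq0; apply/eqP/(@tensor_orth _ _ _ HH) => a b.
  rewrite hdotBr -adjointP// /P aE trE !tensor_dot -adjointP//.
  by rewrite -[mu _]/(hmul mu b y) (muC b y) subrr.
by rewrite -/(P _) adjointP// PE -hdot_adjoint.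
Qed.

End frobenius_normal.

(** * The Jacobson radical is the annihilator *)

Section normal_multiplication_theory.
Variables (R : realType) (H : hilbertType R) (op : H -> H -> H).
Hypothesis nop : normal_multiplication op.
Local Notation star x := (adjoint (op x)).

Let opb := op_bounded nop.
Let mC := opC nop.
Let mA := opA nop.
Let mD x y z : op x (y + z) = op x y + op x z := linearD_fun y z (opb x).1.
Let mB x y z : op x (y - z) = op x y - op x z := linearB_fun y z (opb x).1.
Let mZ a x y : op x (a *: y) = a *: op x y := linearZ_fun a y (opb x).1.
Let m0 x : op x 0 = 0 := linear0_fun (opb x).1.
Let mBl x y z : op (y - z) x = op y x - op z x.
Proof. by rewrite ![op _ x]mC mB. Qed.
Let mZl a x y : op (a *: y) x = a *: op y x.
Proof. by rewrite ![op _ x]mC mZ. Qed.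

Lemma star_mul x z w : op (star x z) w = star x (op z w).
Proof. by rewrite mC -adjoint_op// mC. Qed.

Lemma sqn_star x z : sqn (star x z) = sqn (op x z).
Proof. by rewrite /sqn /rdot -adjointP// -adjoint_op// -hdot_adjoint// . Qed.

Definition annihilator (x : H) := forall y, op x y = 0.

(** The annihilator is the orthogonal complement of the products: normal
    operators and their adjoints have the same kernel. *)
Lemma annihilatorP x : annihilator x <-> forall y z, hdot (op y z) x = 0.
Proof.
split=> [x0 y z|x0 y].
  rewrite adjointP// (_ : star y x = 0) ?hdot0r//.
  by apply: sqn_eq0; rewrite sqn_star mC x0 /sqn /rdot hdot0l.
rewrite mC; apply: sqn_eq0; rewrite -sqn_star.
by rewrite /sqn /rdot -adjointP// x0.
Qed.

Lemma annihilator_radical x : annihilator x -> jacobson_radical op x.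
Proof.
move=> x0 I [_ [[_ _ _ _] [e /(_ x) [h _]]]].
by move: h; rewrite x0 subr0.
Qed.

Lemma radical_ideal : is_ideal op (jacobson_radical op).
Proof.
split=> [I [[[]]]//|x y Jx Jy I mI|a x Jx I mI|x y Jx].
- by have [[[_ ID _ _] _ _] _] := mI; apply: ID; [exact: Jx|exact: Jy].
- by have [[[_ _ IZ _] _ _] _] := mI; apply: IZ; exact: Jx.
- by split=> I mI; have [[[_ _ _ IM] _ _] _] := mI;
    have [] := IM x y (Jx _ mI).
Qed.

(** If h is not of the form z - hz, then the vectors z - hz form a proper ideal
    with modular unit h.  By Zorn an ideal maximal among those that contain it
    and avoid h exists; it is a maximal modular ideal, so it contains h. *)
Lemma radical_quasi_regular h :
  jacobson_radical op h -> exists z, h = z - op h z.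
Proof.
move=> Jh; apply: contrapT => nh.
pose I := range (fun z => z - op h z).
have Iideal : is_ideal op I.
  have IM x y : I x -> I (op x y).
    by move=> [z _ <-]; exists (op z y) => //; rewrite mBl mA.
  split=> [|_ _ [x _ <-] [y _ <-]|a _ [x _ <-]|x y Ix].
  - by exists 0 => //; rewrite m0 subr0.
  - by exists (x + y) => //; rewrite mD opprD addrACA.
  - by exists (a *: x) => //; rewrite mZ scalerBr.
  - by split; [|rewrite mC]; exact: IM.
have Ih : ~ I h by move=> [z _ zh]; apply: nh; exists z.
(* the empty set is included because the union of the empty chain is empty *)
pose P A := A = set0 \/ [/\ is_ideal op A, I `<=` A & ~ A h].
have [F FP Ftot|M [PM Mmax]] := @Zorn_bigcup H P.
  have [[A FA A0]|Fempty] := pselect (exists2 A, F A & A <> set0); last first.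
    left; apply/seteqP; split=> // x [A FA Ax].
    by apply: Fempty; exists A => // A0; rewrite A0 in Ax.
  have FP' B x : F B -> B x -> [/\ is_ideal op B, I `<=` B & ~ B h].
    by move=> FB Bx; have [B0|//] := FP _ FB; rewrite B0 in Bx.
  have [[A0' _ _ _] IA _] : [/\ is_ideal op A, I `<=` A & ~ A h].
    by have [] := FP _ FA.
  right; split.
  - split.
    + by exists A.
    + move=> x y [B FB Bx] [C FC Cy].
      have [[_ BD _ _] _ _] := FP' _ _ FB Bx.
      have [[_ CD _ _] _ _] := FP' _ _ FC Cy.
      have [BC|CB] := Ftot _ _ FB FC.
        by exists C => //; apply: CD => //; exact: BC.
      by exists B => //; apply: BD => //; exact: CB.
    + move=> a x [B FB Bx]; have [[_ _ BZ _] _ _] := FP' _ _ FB Bx.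
      by exists B => //; exact: BZ.
    + move=> x y [B FB Bx]; have [[_ _ _ BM] _ _] := FP' _ _ FB Bx.
      by have [] := BM x y Bx; split; exists B.
  - by move=> x Ix; exists A => //; exact: IA.
  - by move=> [B FB Bh]; have [_ _] := FP' _ _ FB Bh; exact.
have PI : P I by right; split.
have I0 : I 0 by case: Iideal.
have [M0|[Mi IM Mh]] := PM.
  apply: (Mmax I) PI; rewrite M0; split=> // /(_ _ I0).
  by [].
apply: (Mh); apply: Jh; split; last first.
  split=> //; exists h => x; have Ix : I (x - op h x) by exists x.
  by split; apply: IM => //; rewrite mC.
split=> // [MT|J Ji MJ]; first by apply: Mh; rewrite MT.
have [Jh|nJh] := pselect (J h).
  right; apply/seteqP; split=> // x _; rewrite -(subrK (op h x) x).
  case: Ji => _ JD _ JM; apply: JD; last by have [] := JM h x Jh.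
  by apply/MJ/IM; exists x.
left; apply/seteqP; split=> // ; apply: contrapT => nJM.
by apply: (Mmax J); [split|right; split=> // x /IM /MJ].
Qed.

(** Let T be the multiplication by y = x f and h = T^* y.  The multiplication by h is
    the positive operator T^* T, and h = x (T^* f) is in the radical, since a
    radical is an ideal but its stability under T^* is not obvious; this is why
    products x f are considered.  If s = |T|^2 were nonzero, then
    h / s would be quasi-regular, so 1 - T^* T / s would be bounded below.  But
    |w - T^* T w / s|^2 <= |w|^2 - |T w|^2 / s, which would then give
    |T w|^2 <= s (1 - 1 / C) |w|^2 for some C > 0, contradicting the choice of s. *)
Lemma radical_annihilates_products x f :
  jacobson_radical op x -> annihilator (op x f).
Proof.
move=> Jx; set y := op x f; pose h := star y y.
have [_ _ JZ JM] := radical_ideal.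
have Jh : jacobson_radical op h.
  by rewrite /h {2}/y adjoint_op//; have [] := JM x (star y f) Jx.
have hE w : op h w = star y (op y w) by rewrite star_mul.
pose A := [set c : R | 0 <= c /\ forall z, sqn (op y z) <= c * sqn z].
have [c0 Ac0] : exists c, A c by have [c [? ?]] := bounded_sqn (opb y); exists c.
have hA : has_inf A by split; [exists c0|exists 0 => c []].
pose s := inf A.
have s0 : 0 <= s by apply: lb_le_inf; [exists c0|move=> c []].
have As z : sqn (op y z) <= s * sqn z.
  have [z0|zn0] := eqVneq (sqn z) 0.
    by have := Ac0.2 z; rewrite z0 !mulr0.
  have zp : 0 < sqn z by rewrite lt_def zn0 sqn_ge0.
  rewrite -ler_pdivrMr//; apply: lb_le_inf; first by exists c0.
  by move=> c [_ /(_ z)]; rewrite ler_pdivrMr.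
suff s00 : s = 0.
  move=> z; apply: sqn_eq0; apply/eqP; rewrite eq_le sqn_ge0 andbT.
  by have := As z; rewrite s00 mul0r.
apply/eqP/negPn/negP => sn0; have sp : 0 < s by rewrite lt_def sn0.
have [z zE] := radical_quasi_regular (JZ s^-1%:C%C _ Jh).
have [c [cge0 cP]] := bounded_sqn (opb z).
(* from w = v + z v, with z the quasi-inverse and c a bound for its multiplication *)
pose C := 2 + 2 * c.
have Cp : 0 < C by rewrite /C; lra.
have below w : sqn w <= C * (sqn w - s^-1 * sqn (op y w)).
  set v := w - s^-1%:C%C *: op h w.
  have wE : w = v + op z v.
    have vE : v = w - op (s^-1%:C%C *: h) w by rewrite mZl.
    have -> : op z v = op (s^-1%:C%C *: h) w.
      by rewrite vE mB mA (mC z (_ *: _)) -mBl -zE.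
    by rewrite vE subrK.
  have vle : sqn v <= sqn w - s^-1 * sqn (op y w).
    rewrite /v sqnB sqnZr rdotZr hE sqn_star.
    have -> : rdot w (star y (op y w)) = sqn (op y w).
      by rewrite /rdot -adjointP.
    have := As (op y w); set q := sqn _; set p := sqn (op y w) => qp.
    have : s^-1 ^+ 2 * q <= s^-1 * p.
      by rewrite expr2 -mulrA ler_pM2l ?invr_gt0// ler_pdivrMl.
    by lra.
  have := sqnD_le v (op z v); rewrite -wE; have := cP v.
  have := sqn_ge0 v; rewrite /C; nra.
have : A (s * (1 - C^-1)).
  split.
    rewrite mulr_ge0// subr_ge0 invf_le1// /C; lra.
  move=> w; have := below w; set q := sqn w; set p := sqn _ => qp.
  rewrite -mulrA -ler_pdivrMl// mulrBl mul1r lerBrDl -lerBrDr ler_pdivrMl//.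
move=> /(ge_inf hA.2); rewrite -/s; apply/negP; rewrite -ltNge.
by rewrite gtr_pMr// gtrBl invr_gt0.
Qed.

(** For x in the radical, x f is both a product and an annihilator, hence
    orthogonal to itself. *)
Lemma semisimple_annihilator :
  jacobson_radical op = [set 0] <-> forall x, annihilator x -> x = 0.
Proof.
split=> [J0 x /annihilator_radical|ann0]; first by rewrite J0.
apply/seteqP; split=> [x Jx|_ ->]; last by case: radical_ideal.
apply: ann0 => f; have /annihilatorP := radical_annihilates_products f Jx.
by move=> /(_ x f) h; apply: sqn_eq0; rewrite /sqn /rdot h.
Qed.

End normal_multiplication_theory.

(** * Approximate units *)

Section approximate_units.
Variables (R : realType) (H : hilbertType R) (op : H -> H -> H).
Hypothesis nop : normal_multiplication op.
Hypothesis ann0 : forall x, annihilator op x -> x = 0.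

(** In the power of H indexed by I, the vectors (u_i e)_i form a subspace V that is
    stable under all multiplications and their adjoints.  Let l be the projection
    of u on the closure of V and r = u - l.  Then r x lies in the closure of V,
    because u x does and l x does, but also in its orthogonal complement; hence
    r x = 0 for all x, so that r = 0 and u is in the closure of V. *)
Lemma approximate_identity (I : finType) (u : I -> H) (eps : R) : 0 < eps ->
  exists e, forall i, sqn (u i - op (u i) e) < eps.
Proof.
have [opb mC mA adj] := nop; move=> eps0.
pose D (v : I -> H) (a : R) :=
  (exists e, forall i, v i = op (u i) e) /\ a = \sum_i rdot (u i) (v i).
have [||||l [lapp lD _]] := @riesz_graph R H I D (\sum_i sqn (u i)).
- split; first by exists 0 => i; rewrite (linear0_fun (opb _).1).
  by rewrite big1// => i _; rewrite /rdot hdot0r.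
- move=> k v w a b [[e ve] ->] [[f wf] ->]; split.
    exists (e + k%:C%C *: f) => i.
    by rewrite (linearD_fun _ _ (opb _).1) (linearZ_fun _ _ (opb _).1) ve wf.
  rewrite mulr_sumr -big_split/=; apply: eq_bigr => i _.
  by rewrite rdotDr rdotZr.
- exact: sumQ_ge0.
- by move=> v a [_ ->]; exact: sum_CauchySchwarz.
pose r i := u i - l i.
have rorth f : \sum_i rdot (r i) (op (u i) f) = 0.
  under eq_bigr do rewrite /r rdotDl rdotNl; rewrite big_split/= sumrN.
  apply/eqP; rewrite subr_eq0; apply/eqP/lD; by split=> //; exists f.
(* With v = u e close to l, x^* x (u - v) = u f is in V, so that
   |x r|^2 = <r, x^* x (r - (u - v))> = <x r, x (v - l)>. *)
have rx x : \sum_i sqn (op x (r i)) = 0.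
  have [c [c0 cP]] := bounded_sqn (opb x).
  set A := \sum_i _; have A0 : 0 <= A by exact: sumQ_ge0.
  apply/eqP; rewrite eq_le A0 andbT; apply/ler_addgt0Pl => d d0; rewrite addr0.
  have [|v [_ [[[e ve] _] vl]]] := lapp (d / (c + 1)).
    by rewrite divr_gt0// ltr_wpDl.
  pose w i := v i + (-1)%:C%C *: l i.
  have AE : A = \sum_i rdot (op x (r i)) (op x (w i)).
    pose f := adjoint (op x) (x - op x e).
    rewrite -[RHS]add0r -[X in X + _](rorth f) -big_split/=; apply: eq_bigr => i _.
    have -> : rdot (r i) (op (u i) f)
        = rdot (op x (r i)) (op x (u i - op (u i) e)).
      rewrite /f -adj /rdot -adjointP// !(linearB_fun _ _ (opb _).1).
      by rewrite (mC (u i) x) !mA (mC (u i) x).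
    rewrite -rdotDr -(linearD_fun _ _ (opb x).1) /sqn; congr (rdot _ (op x _)).
    by rewrite /w ve rmorphN1 scaleN1r subrKA.
  have Bd : \sum_i sqn (op x (w i)) <= d.
    apply: (@le_trans _ _ (c * \sum_i sqn (w i))).
      by rewrite mulr_sumr; apply: ler_sum => i _; exact: cP.
    apply: (@le_trans _ _ (c * (d / (c + 1)))).
      by rewrite ler_wpM2l// ltW.
    rewrite mulrCA ger_pMr// ler_pdivrMr ?ltr_wpDl// mul1r lerDl//.
  have := sum_CauchySchwarz (fun i => op x (r i)) (fun i => op x (w i)).
  rewrite -AE -/A; have [->|An0] := eqVneq A 0; first by move=> _; exact: ltW.
  have Ap : 0 < A by rewrite lt_def An0.
  by rewrite expr2 ler_pM2l// => /le_trans; apply.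
have ul i : u i = l i.
  apply/eqP; rewrite -subr_eq0; apply/eqP/ann0 => x; rewrite mC; apply: sqn_eq0.
  apply/eqP; rewrite eq_le sqn_ge0 andbT -(rx x).
  exact: (sumQ_coord i (fun i => op x (r i))).
have [v [_ [[[e ve] _] vl]]] := lapp _ eps0.
exists e => i; apply: le_lt_trans vl.
rewrite -sqnN opprB -ve ul -scaleN1r -(rmorphN1 (real_complex R)).
exact: (sumQ_coord i (fun i => v i + (-1)%:C%C *: l i)).
Qed.

End approximate_units.

Section nets.
Variables (R : realType) (H : hilbertType R).

Lemma net_cvgP (L : Type) (le : L -> L -> Prop) (F : L -> H) (u : H) :
  F @ net_tails le --> u <-> forall eps : R, 0 < eps ->
    exists i, forall j, le i j -> sqn (u - F j) < eps.
Proof.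
split=> [Fu eps eps0|Fu A /nbhs_ballP[[e e'] /=]].
  have se0 : 0 < Num.sqrt eps by rewrite sqrtr_gt0.
  have [|i _ iP] := Fu (ball u (Num.sqrt eps)%:C%C).
    by apply: nbhsx_ballx; rewrite ltcR.
  exists i => j /iP; rewrite /= -ball_normE /ball_ /= norm_lt//.
  by rewrite sqr_sqrtr ?ltW.
rewrite ltcE /= => /andP[/eqP -> e0] eA.
have [i iP] := Fu _ (exprn_gt0 2 e0).
exists i => // j /iP ?; apply: eA; rewrite -ball_normE /ball_ /=.
by have -> : (e +i* 0)%C = e%:C%C by []; rewrite norm_lt.
Qed.

End nets.

(** * Approximate counits and the equivalences *)

Section counits.
Variables (R : realType) (H : hilbertType R) (HH : hilbertTensor H H).
Variables (HC : hilbertTensor H (complexn R)) (mu : HH -> H).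
Hypothesis mub : bounded_linear mu.
Hypothesis nop : normal_multiplication (hmul mu).

Lemma sqn_complexn1 : sqn ((1 : R[i]) : complexn R) = 1.
Proof.
by rewrite /sqn /rdot [hdot _ _](_ : _ = 1 * Num.conj (1 : R[i]))// rmorph1 mulr1.
Qed.

Definition riesz_functional (e : H) : H -> complexn R := fun y => hdot y e.

Lemma riesz_functional_bounded e : bounded_linear (riesz_functional e).
Proof.
apply: (@sqn_bounded _ _ _ _ (sqn e)) => [a x y|x].
  by rewrite /riesz_functional hdotDl hdotZl.
by rewrite -lecR -hdot_sqn -hdot_norm mulrC; exact: hdot_CauchySchwarz.
Qed.

(** Both sides are tested against v (x) c; the adjoint of id (x) <., e> sends it to
    c v (x) e, and <delta u, v (x) e> = <u, v e>, where delta is the adjoint of mu. *)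
Lemma riesz_functional_comultiplication e u :
  tmap HH HC idfun (riesz_functional e) (adjoint mu u)
    = tensor HC (adjoint (hmul mu e) u) (1 : R[i]).
Proof.
have [opb mC _ _] := nop; have [Fb FE] := tmap_rP HH HC (riesz_functional_bounded e).
set F := tmap _ _ _ _ in Fb FE *.
have aF v c : adjoint F (tensor HC v c) = (c : R[i]) *: tensor HH v e.
  apply/eqP; rewrite -subr_eq0; apply/eqP/(@tensor_orth _ _ _ HH) => a b.
  rewrite hdotBr -adjointP// FE !tensor_dot hdotZr tensor_dot.
  by rewrite [X in _ * X - _](_ : _ = hdot b e * Num.conj (c : R[i])) //; ring.
apply/eqP; rewrite -subr_eq0; apply/eqP/(@tensor_orth _ _ _ HC) => v c.
rewrite hdotBr (@hdot_adjoint _ _ _ F)// aF hdotZl -adjointP// tensor_dot.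
rewrite -adjointP// -[mu _]/(hmul mu v e) (mC v e).
rewrite [X in _ - _ * X](_ : _ = (c : R[i]) * Num.conj (1 : R[i]))//.
by rewrite rmorph1 mulr1 mulrC subrr.
Qed.

(** The multiplication by e minus the identity is normal, so it and its adjoint
    have the same norm at u: at u, the vector e is as good a unit as <., e> is a
    counit. *)
Lemma counit_riesz_functional e u :
  sqn (tensor HC u (1 : R[i])
       - tmap HH HC idfun (riesz_functional e) (adjoint mu u)) = sqn (u - hmul mu u e).
Proof.
have [opb mC _ _] := nop; rewrite riesz_functional_comultiplication -linearBl tensor_sqn.
rewrite sqn_complexn1 mulr1 !sqnB sqn_star// (mC u e); congr (_ - _ * _ + _).
by rewrite rdotC [RHS]rdotC /rdot -hdot_adjoint// -[LHS]/(rdot _ _) rdotC.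
Qed.

Lemma annihilator_comultiplication u :
  annihilator (hmul mu) u -> adjoint mu u = 0.
Proof.
move=> /(annihilatorP nop) u0; apply: (@tensor_orth _ _ _ HH) => x y.
by rewrite -adjointP//; exact: u0.
Qed.

(** The net is indexed by the pairs (s, n) of a finite list and a precision: its
    term is a unit up to 1 / (n + 1) on the members of s. *)
Lemma approximate_unit_iff :
  has_approximate_unit mu <-> forall x, annihilator (hmul mu) x -> x = 0.
Proof.
split=> [[L [le [e [dle eu]]]] x x0|ann0].
  apply: sqn_small => eps eps0; have [i /(_ i)] := (net_cvgP _ _ _).1 (eu x) _ eps0.
  by rewrite x0 subr0 => h; apply/ltW/h; exact: (directed_refl dle).
pose le (p q : seq H * nat) := {subset p.1 <= q.1} /\ (p.2 <= q.2)%N.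
have /choice [e eP] : forall p : seq H * nat, exists e, forall u, u \in p.1 ->
    sqn (u - hmul mu u e) < p.2.+1%:R^-1.
  move=> [s n] /=.
  have [|e eP] := @approximate_identity _ _ _ nop ann0 'I_(size s)
    (fun i => s`_i) n.+1%:R^-1; first by rewrite invr_gt0.
  exists e => u us; have us' : (index u s < size s)%N by rewrite index_mem.
  by have := eP (Ordinal us'); rewrite /= nth_index.
exists (seq H * nat)%type, le, e; split.
  split; first by split; exact: ([::], 0%N).
  - by move=> p; split.
  - move=> q p r [pq pq'] [qr qr']; split; last exact: leq_trans qr'.
    by move=> x /pq /qr.
  - move=> [s m] [t n]; exists (s ++ t, maxn m n); split; split=> /=.
    + by move=> x xs; rewrite mem_cat xs.
    + exact: leq_maxl.
    + by move=> x xs; rewrite mem_cat xs orbT.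
    + exact: leq_maxr.
move=> u; apply/net_cvgP => eps eps0.
exists ([:: u], Num.trunc eps^-1) => -[s n] [/= us nN].
apply: lt_le_trans (eP (s, n) u _) _ => /=; first by apply: us; rewrite inE.
rewrite invf_ple ?posrE ?ltr0n//.
by apply/ltW/(lt_le_trans (truncnS_gt _)); rewrite ler_nat ltnS.
Qed.

(** An annihilator u has comultiplication 0, so every counit sends it to 0, and
    u (x) 1 is a limit of zeros. *)
Lemma approximate_counit_iff :
  has_approximate_counit HC mu <-> forall x, annihilator (hmul mu) x -> x = 0.
Proof.
split=> [[L [le [eps [dle epsb cu]]]] u u0|/approximate_unit_iff].
  apply: sqn_small => d d0; have [i /(_ i)] := (net_cvgP _ _ _).1 (cu u) _ d0.
  rewrite annihilator_comultiplication//.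
  have [Fb _] := tmap_rP HH HC (epsb i); rewrite (linear0_fun Fb.1) subr0.
  rewrite tensor_sqn sqn_complexn1 mulr1 => h; apply/ltW/h; exact: (directed_refl dle).
move=> [L [le [e [dle eu]]]]; exists L, le, (fun i => riesz_functional (e i)); split=> //.
  by move=> i; exact: riesz_functional_bounded.
move=> u; apply/net_cvgP => d d0.
have [i iP] := (net_cvgP _ _ _).1 (eu u) _ d0.
by exists i => j /iP; rewrite counit_riesz_functional.
Qed.

Lemma special_annihilator :
  special mu -> forall x, annihilator (hmul mu) x -> x = 0.
Proof.
move=> sp x /annihilator_comultiplication x0.
have /(congr1 (fun f => f x)) /= <- := sp.
by rewrite x0 (linear0_fun mub.1).
Qed.

End counits.

Theorem corollary41 (R : realType) (H : hilbertType R)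
    (HH : hilbertTensor H H)
    (HH_H : hilbertTensor HH H) (H_HH : hilbertTensor H HH)
    (HC : hilbertTensor H (complexn R))
    (mu : HH -> H) :
  hilbertian_frobenius_semigroup HH_H H_HH mu ->
  [/\ semisimple mu <-> has_approximate_unit mu,
      has_approximate_unit mu <-> has_approximate_counit HC mu
    & special mu -> has_approximate_unit mu /\ has_approximate_counit HC mu].
Proof.
move=> frob; have nop := frobenius_normal frob.
have [[mub _ _] _ _] := frob.
have unitP := approximate_unit_iff nop.
have counitP := approximate_counit_iff HC mub nop.
split; first by rewrite /semisimple (semisimple_annihilator nop) unitP.
  by rewrite unitP counitP.
by move=> /(special_annihilator mub nop) ann0; split; [apply/unitP|apply/counitP].
Qed.
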